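(* Let $R$ be a ring with identity and let $\mathcal{S}$ be a set-presentable class of finitely presented left $R$-modules with $R\in\mathcal{S}$. Then every left $R$-module $M$ admits an $\mathcal{S}$-pure injective preenvelope.
   Context: All rings have an identity (not necessarily commutative) and $R$-module means unitary left $R$-module. A class $\mathcal{S}$ of $R$-modules is set-presentable if it has a subset $\mathcal{S}^*$ (a set) such that every $U\in\mathcal{S}$ is isomorphic to some $U^*\in\mathcal{S}^*$. A short exact sequence $0\to A\to B\to C\to 0$ of $R$-modules is $\mathcal{S}$-pure if for all $U\in\mathcal{S}$ the induced map $\mathrm{Hom}_R(U,B)\to\mathrm{Hom}_R(U,C)$ is surjective. An $R$-module $E$ is $\mathcal{S}$-pure injective if for every $\mathcal{S}$-pure exact sequence $0\to A\to B\to C\to 0$ the induced map $\mathrm{Hom}_R(B,E)\to\mathrm{Hom}_R(A,E)$ is surjective. For a class $\mathscr{X}$ of $R$-modules, an $\mathscr{X}$-preenvelope of $M$ is a homomorphism $\phi:M\to X$ with $X\in\mathscr{X}$ such that for every $X'\in\mathscr{X}$ the induced map $\mathrm{Hom}_R(X,X')\to\mathrm{Hom}_R(M,X')$ is surjective. An $\mathcal{S}$-pure injective preenvelope is an $\mathscr{X}$-preenvelope where $\mathscr{X}$ is the class of $\mathcal{S}$-pure injective $R$-modules. *)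

(* Defs.v *)
From HB Require Import structures.
From mathcomp Require Import all_boot all_order all_algebra.

Set Implicit Arguments.
Unset Strict Implicit.
Unset Printing Implicit Defensive.

Import GRing.Theory.
Local Open Scope ring_scope.

Section RelativePurity.
Variable R : pzRingType.
Implicit Types A B C E M U V X : lmodType R.

Definition isomorphic U V : Prop := exists f : {linear U -> V}, bijective f.

(* A set of modules is a family indexed by a type in the universe of the
   carriers of R-modules: with an unconstrained index type one could take
   lmodType R itself as index, and every class would be set-presentable. *)
Definition set_presentable (S : lmodType R -> Prop) : Prop :=
  exists (I : Type@{GRing.Lmodule.axioms_.u0}) (Sstar : I -> lmodType R),
    (forall i, S (Sstar i)) /\ (forall U, S U -> exists i, isomorphic U (Sstar i)).

Definition exact_at A B C (f : {linear A -> B}) (g : {linear B -> C}) : Prop :=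
  forall b, g b = 0 <-> exists a, f a = b.

Definition surjective_map A B (f : A -> B) : Prop := forall b, exists a, f a = b.

(* The rows 'rV[R]_n carry the left action of R, so they are the left module R^n. *)
Definition finitely_presented M : Prop :=
  exists (m n : nat) (r : {linear 'rV[R]_m -> 'rV[R]_n})
         (p : {linear 'rV[R]_n -> M}),
    exact_at r p /\ surjective_map p.

Definition short_exact A B C (f : {linear A -> B}) (g : {linear B -> C}) : Prop :=
  [/\ injective f, exact_at f g & surjective_map g].

Definition Hom_post_surjective U B C (g : {linear B -> C}) : Prop :=
  forall h : {linear U -> C}, exists k : {linear U -> B}, g \o k =1 h.

Definition Hom_pre_surjective A B E (f : {linear A -> B}) : Prop :=
  forall h : {linear A -> E}, exists k : {linear B -> E}, k \o f =1 h.

Definition pure_exact (S : lmodType R -> Prop) A B C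
    (f : {linear A -> B}) (g : {linear B -> C}) : Prop :=
  short_exact f g /\ forall U, S U -> Hom_post_surjective U g.

Definition pure_injective (S : lmodType R -> Prop) E : Prop :=
  forall A B C (f : {linear A -> B}) (g : {linear B -> C}),
    pure_exact S f g -> Hom_pre_surjective E f.

Definition is_preenvelope (XX : lmodType R -> Prop) M X
    (phi : {linear M -> X}) : Prop :=
  XX X /\ forall X', XX X' -> Hom_pre_surjective X' phi.

End RelativePurity.

(* Main.v *)
(** As the modules in S are finitely presented, S-purity says that certain finite linear
    systems P x = a with constants in A which are solvable in B are solvable in A.
    For such a matrix P, let P* be the left R-module of additive characters
    R^m -> Q/Z (R^m as a right module of columns) vanishing on P R^n.  A linear
    map A -> P* amounts to a character of A^m vanishing on P A^n; as Q/Z is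
    divisible, such characters extend along S-pure monomorphisms, so P* is S-pure
    injective, and they separate P A^n from the rest of A^m.  Hence the evaluation
    map of M into the product of all P*, indexed by all P and all linear maps
    M -> P*, is an S-pure monomorphism into an S-pure injective module, and every
    map from M to an S-pure injective module extends along it. *)

Require Import Defs.
From HB Require Import structures.
From mathcomp Require Import all_boot all_order all_algebra.
From mathcomp Require Import boolp classical_sets functions.

Set Implicit Arguments.
Unset Strict Implicit.
Unset Printing Implicit Defensive.

Import Order.TTheory GRing.Theory Num.Theory.
Local Open Scope ring_scope.
Local Open Scope classical_set_scope.

(** * Extension of additive maps into divisible groups *)

(** Euclidean division by the least positive element of [H] leaves a remainder in [H], hence 0; if
    no element is positive, n = 0. *)
Lemma int_subgroup_principal (H : set int) :
    H 0 -> (forall k l, H k -> H l -> H (k - l)) ->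
  exists2 n : nat, H n & forall k, H k -> exists q : int, k = q * n.
Proof.
move=> H0 HB.
have HN k : H k -> H (- k) by move=> Hk; rewrite -sub0r; exact: HB.
have HD k l : H k -> H l -> H (k + l).
  by move=> Hk Hl; rewrite -[l]opprK; apply: HB => //; exact: HN.
have HM k l : H k -> H (l * k).
  move=> Hk; elim/int_rec: l => [|l IH|l IH]; first by rewrite mul0r.
  - by rewrite -addn1 PoszD mulrDl mul1r; exact: HD.
  - by rewrite -addn1 PoszD opprD mulrDl mulN1r; apply: HB.
have [exH|noH] := pselect (exists n : nat, (0 < n)%N && `[< H n >]); last first.
  exists 0%N => // k Hk; exists 0; rewrite mul0r; apply: contrapT => /eqP k0.
  apply: noH; exists `|k|%N; rewrite absz_gt0 k0; apply/asboolP.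
  have [k_ge0|k_lt0] := lerP 0 k; first by rewrite gez0_abs.
  by rewrite ltz0_abs //; exact: HN.
case: (ex_minnP exH) => n /andP[n_gt0 /asboolP Hn] nmin.
exists n => // k Hk; exists (k %/ n)%Z.
have n0z : (n%:Z != 0) by rewrite eqz_nat -lt0n.
rewrite {1}(divz_eq k n); suff -> : (k %% n)%Z = 0 by rewrite addr0.
have Hr : H (k %% n)%Z by rewrite /modz; apply: HB => //; exact: HM.
have := modz_ge0 k n0z; have := ltz_pmod k (d := n) n_gt0.
case: (k %% n)%Z Hr => [[|r]|r] // Hr.
by rewrite ltz_nat ltnNge => /negP[]; apply: nmin; apply/asboolP.
Qed.

Section AdditiveGraphs.
Variables G D : zmodType.
Implicit Types F : set (G * D).

(* F is the graph of an additive map from a subgroup of G to D. *)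
Definition additive_graph F : Prop :=
  [/\ F 0, forall u v, F u -> F v -> F (u - v) & forall d, F (0, d) -> d = 0].

Definition divisible : Prop :=
  forall (n : nat) (d : D), (0 < n)%N -> exists e, e *+ n = d.

Lemma pairMz (u : G * D) (k : int) : u *~ k = (u.1 *~ k, u.2 *~ k).
Proof. by rewrite [LHS]surjective_pairing !raddfMz. Qed.

Lemma additive_graphMz F u (k : int) : additive_graph F -> F u -> F (u *~ k).
Proof.
move=> [F0 FB _] Fu; elim/int_rec: k => [|n IH|n IH]; first by rewrite mulr0z.
- rewrite -addn1 PoszD mulrzDr mulr1z -[u in _ + u]opprK; apply: (FB) => //.
  by rewrite -sub0r; apply: (FB 0).
- by rewrite -addn1 PoszD opprD mulrzDr mulrN1z; apply: FB.
Qed.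

Lemma additive_graph_inj F g d e :
  additive_graph F -> F (g, d) -> F (g, e) -> d = e.
Proof.
move=> [_ FB F1] Fd Fe; apply/eqP; rewrite -subr_eq0; apply/eqP/F1.
by have := FB _ _ Fd Fe; congr F; congr pair; exact: subrr.
Qed.

(** The sum of [F] and the cyclic group generated by [(g, d)]: the candidate graph for extending the
    map by g |-> d. *)
Definition adjoin F g d : set (G * D) :=
  [set u | exists k : int, F (u - (g, d) *~ k)].

Lemma additive_graph_adjoin F g d :
    additive_graph F -> (forall (k : int) y, F (g *~ k, y) -> y = d *~ k) ->
  additive_graph (adjoin F g d).
Proof.
move=> [F0 FB F1] compat; split.
- by exists 0; rewrite mulr0z subr0.
- move=> u v [k Fu] [l Fv]; exists (k - l); have := FB _ _ Fu Fv; congr F.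
  by rewrite mulrzBr !opprB addrACA [in RHS]addrACA [- v - _]addrC.
- move=> e [k]; move=> Fe; apply/eqP.
  rewrite -(subrK (d *~ k) e) addr_eq0 -mulrNz; apply/eqP/compat.
  suff -> : (g *~ (- k), e + d *~ (- k)) = (0, e) - (g, d) *~ k by [].
  by rewrite pairMz !mulrNz -[- (g *~ k)]sub0r.
Qed.

Lemma sub_adjoin F g d : F `<=` adjoin F g d.
Proof. by move=> u Fu; exists 0; rewrite mulr0z subr0. Qed.

Lemma adjoin_point F g d : F 0 -> adjoin F g d (g, d).
Proof. by exists 1; rewrite mulr1z subrr. Qed.

(** The k with kg in the domain of [F] form a subgroup nZ of the integers, so only the one equation
    nd = F(ng) has to be solved, by divisibility if n > 0 and by d = 0 otherwise. *)
Lemma divisible_compat F g : divisible -> additive_graph F ->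
  exists d, forall (k : int) y, F (g *~ k, y) -> y = d *~ k.
Proof.
move=> divD gF; have [F0 FB F1] := gF.
have [||n [y0 Fy0] gen] :=
    @int_subgroup_principal [set k : int | exists y, F (g *~ k, y)].
- by exists 0; rewrite mulr0z.
- move=> k l [y Fy] [z Fz]; exists (y - z); rewrite mulrzBr; exact: (FB _ _ Fy Fz).
have [d dE] : exists d, d *+ n = y0.
  case: n {gen} Fy0 => [|n] Fy0; last exact: divD.
  by exists 0; rewrite mul0rn; apply/esym/F1; move: Fy0; rewrite mulr0z.
exists d => k y Fy; have [q kE] := gen k (ex_intro _ y Fy).
apply: (additive_graph_inj gF Fy); have := additive_graphMz q gF Fy0.
by rewrite pairMz /= -mulrzA -dE pmulrn -mulrzA kE mulrC.
Qed.

(** Divisible groups are injective: a graph maximal by Zorn's lemma is total, since it could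
    otherwise be extended to one more element. *)
Lemma additive_graph_extension F : divisible -> additive_graph F ->
  exists chi : {additive G -> D}, forall u, F u -> chi u.1 = u.2.
Proof.
(* The empty chain must be admissible in Zorn_bigcup, hence the union with F. *)
move=> divD gF; pose P := [set A | additive_graph (A `|` F)].
have [|A [gA maxA]] := @Zorn_bigcup _ P.
  move=> C CP Ctot.
  (* The chain being total, two points of the union lie in one admissible graph, where closure can
     be checked. *)
  have join u v : (\bigcup_(X in C) X `|` F) u -> (\bigcup_(X in C) X `|` F) v ->
      exists Z, [/\ additive_graph (Z `|` F), (Z `|` F) u, (Z `|` F) v
        & Z `|` F `<=` \bigcup_(X in C) X `|` F].
    have sub X : C X -> X `|` F `<=` \bigcup_(X in C) X `|` F.
      by move=> CX w [Xw|Fw]; [left; exists X|right].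
    move=> [[X CX Xu]|Fu] [[Y CY Yv]|Fv].
    - have [XY|YX] := Ctot _ _ CX CY.
      + by exists Y; split; [exact: CP|left; exact: XY|left|exact: sub].
      + by exists X; split; [exact: CP|left|left; exact: YX|exact: sub].
    - by exists X; split; [exact: CP|left|right|exact: sub].
    - by exists Y; split; [exact: CP|right|left|exact: sub].
    - exists set0; rewrite set0U; split=> // w; exact: or_intror.
  split; first by right; case: gF.
  - by move=> u v Cu /(join _ _ Cu)[Z [[_ ZB _] Zu Zv]]; apply; exact: ZB.
  - by move=> d Cd; have [Z [[_ _ Z1] Zd _ _]] := join _ _ Cd Cd; exact: Z1.
have total g : exists d, (A `|` F) (g, d).
  have [d dP] := divisible_compat g divD gA.
  have [B0 _ _] := gA; have gB := additive_graph_adjoin gA dP.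
  exists d; apply: contrapT => nB; apply: (maxA (adjoin (A `|` F) g d)).
    split; first by move=> u Au; apply: sub_adjoin; left.
    by move=> sBA; apply: nB; left; apply: sBA; exact: adjoin_point.
  rewrite /P /= (setUidl _) // => u Fu; apply: sub_adjoin; by right.
have [chi chiP] := choice total.
have chiB : zmod_morphism chi.
  move=> x y; have [_ AB _] := gA.
  by apply: (additive_graph_inj gA (chiP _)); exact: (AB _ _ (chiP x) (chiP y)).
pose addchi := GRing.isZmodMorphism.Build G D chi chiB.
pose f : {additive G -> D} := HB.pack chi addchi.
exists f => -[g d] Fu; apply: (additive_graph_inj gA (chiP g)); by right.
Qed.

End AdditiveGraphs.

(** * The group Q/Z and separation by its characters *)

Definition rat_int : zmodClosed rat :=
  GRing.ZmodClosed.clone rat (@Num.int_num_subdef rat) _.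

Definition QZ : zmodType := Quotient.quot rat_int.

Definition piQZ : rat -> QZ := \pi_(Quotient.quot rat_int)%qT.

Lemma piQZ_is_zmod_morphism : zmod_morphism piQZ.
Proof. exact: (pi_is_zmod_morphism (Quotient.quot rat_int)). Qed.

HB.instance Definition _ :=
  GRing.isZmodMorphism.Build rat QZ piQZ piQZ_is_zmod_morphism.

Lemma piQZ_eq0 (x : rat) : (piQZ x == 0) = (x \is a Num.int).
Proof.
rewrite -(raddf0 piQZ) /piQZ -(Quotient.idealrBE rat_int) subr0.
by [].
Qed.

Lemma divisible_QZ : divisible QZ.
Proof.
move=> n d n_gt0; exists (piQZ (repr d / n%:R)).
rewrite -raddfMn -[_ *+ n]mulr_natr divfK ?pnatr_eq0 -?lt0n //.
exact: reprK.
Qed.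

(** The class of 1/n serves for n > 1, and any nonzero class, say that of 1/2, for n = 0. *)
Lemma QZ_torsion (n : nat) : n != 1%N -> exists2 d : QZ, d != 0 & d *+ n = 0.
Proof.
have nint (m : nat) : (1 < m)%N -> piQZ m%:R^-1 != 0.
  move=> m_gt1; rewrite piQZ_eq0; apply/negP => /intrP[k kE].
  have m_gt0 : (0 < m%:R :> rat) by rewrite ltr0n (ltn_trans _ m_gt1).
  have : 0 < k%:~R :> rat by rewrite -kE invr_gt0.
  have : k%:~R < 1 :> rat by rewrite -kE invf_lt1 // ltr1n.
  by rewrite ltr0z ltrz1; case: k {kE} => [[|k]|k].
case: n => [|[|n]] // _.
  by exists (piQZ 2%:R^-1); [exact: nint|rewrite mulr0n].
exists (piQZ n.+2%:R^-1); first exact: nint.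
apply/eqP; rewrite -raddfMn -[_ *+ _]mulr_natr mulVf ?pnatr_eq0 // piQZ_eq0.
exact: int_num1.
Qed.

(** The order n of [a] modulo [H], taken as 0 if infinite, is not 1, so some nonzero d is killed by
    n. Sending [H] to 0 and [a] to d is then consistent and extends to [G]. *)
Lemma QZ_separation (G : zmodType) (H : set G) (a : G) :
    H 0 -> (forall x y, H x -> H y -> H (x - y)) -> ~ H a ->
  exists2 chi : {additive G -> QZ}, (forall x, H x -> chi x = 0) & chi a != 0.
Proof.
move=> H0 HB nHa.
have [||n Hn gen] := @int_subgroup_principal [set k : int | H (a *~ k)].
- by rewrite /= mulr0z.
- by move=> k l Hk Hl /=; rewrite mulrzBr; exact: HB.
have [|d d0 dn] := @QZ_torsion n.
  by apply/eqP => n1; apply: nHa; move: Hn; rewrite n1.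
pose F : set (G * QZ) := [set u | H u.1 /\ u.2 = 0].
have gF : additive_graph F.
  split=> [|u v [Hu u0] [Hv v0]|e [_ //]]; first by [].
  by split; [exact: HB|rewrite /= u0 v0 subr0].
have gF' : additive_graph (adjoin F a d).
  apply: additive_graph_adjoin => // k y [/= Hk ->].
  by have [q ->] := gen k Hk; rewrite mulrC mulrzA -pmulrn dn mul0rz.
have [chi chiP] := additive_graph_extension divisible_QZ gF'.
exists chi => [x Hx|].
  by apply: (chiP (x, 0)); apply: sub_adjoin.
by rewrite (chiP (a, d)) //; apply: adjoin_point; case: gF.
Qed.

(** * Cokernels and products of modules *)

Section QuotientModule.
Variables (R : pzRingType) (V : lmodType R) (S : zmodClosed V).
Hypothesis SZ : GRing.scaler_closed S.

(* The proof of stability under scaling is an argument of the type because the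
   module structure of the quotient depends on it. *)
Definition quotmod of GRing.scaler_closed S : Type := Quotient.quot S.
Local Notation Q := (quotmod SZ).

HB.instance Definition _ := GRing.Zmodule.on Q.

Definition quot_proj : V -> Q := \pi_(Quotient.quot S)%qT.

Definition quot_scale (a : R) (q : Q) : Q := quot_proj (a *: repr q).

Lemma quot_projB : zmod_morphism quot_proj.
Proof. exact: (pi_is_zmod_morphism (Quotient.quot S)). Qed.

HB.instance Definition _ := GRing.isZmodMorphism.Build V Q quot_proj quot_projB.

Lemma quot_proj_eq x y : (quot_proj x == quot_proj y) = (x - y \in S).
Proof. by rewrite (Quotient.idealrBE S). Qed.

Lemma quot_proj_surj (q : Q) : quot_proj (repr q) = q.
Proof. exact: reprK. Qed.

Lemma quot_scale_proj a x : quot_scale a (quot_proj x) = quot_proj (a *: x).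
Proof.
apply/eqP; rewrite quot_proj_eq -scalerBr SZ // -quot_proj_eq.
by rewrite quot_proj_surj.
Qed.

Lemma quot_scaleA a b q : quot_scale a (quot_scale b q) = quot_scale (a * b) q.
Proof. by rewrite -(quot_proj_surj q) !quot_scale_proj scalerA. Qed.

Lemma quot_scale1 : left_id 1 quot_scale.
Proof. by move=> q; rewrite -(quot_proj_surj q) quot_scale_proj scale1r. Qed.

Lemma quot_scaleDr : right_distributive quot_scale +%R.
Proof.
move=> a p q; rewrite -(quot_proj_surj p) -(quot_proj_surj q).
by rewrite -raddfD !quot_scale_proj -raddfD scalerDr.
Qed.

Lemma quot_scaleDl q : {morph quot_scale^~ q : a b / a + b}.
Proof.
by move=> a b; rewrite -(quot_proj_surj q) !quot_scale_proj -raddfD scalerDl.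
Qed.

HB.instance Definition _ := GRing.Zmodule_isLmodule.Build R Q
  quot_scaleA quot_scale1 quot_scaleDr quot_scaleDl.

Lemma quot_projZ : scalable quot_proj.
Proof. by move=> a x; rewrite -quot_scale_proj. Qed.

HB.instance Definition _ := GRing.isScalable.Build R V Q *:%R quot_proj quot_projZ.

End QuotientModule.

Lemma cokernel (R : pzRingType) (A B : lmodType R) (f : {linear A -> B}) :
  injective f -> exists (C : lmodType R) (g : {linear B -> C}), short_exact f g.
Proof.
move=> f_inj; pose S : pred B := fun b => `[< exists a, f a = b >].
have S_closed : zmod_closed S.
  split; first by apply/asboolP; exists 0; rewrite raddf0.
  move=> _ _ /asboolP[x <-] /asboolP[y <-]; apply/asboolP.
  by exists (x - y); rewrite raddfB.
have SZ : GRing.scaler_closed S.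
  by move=> a _ /asboolP[x <-]; apply/asboolP; exists (a *: x); rewrite linearZ.
pose mS := GRing.isZmodClosed.Build B S S_closed.
pose S' : zmodClosed B := HB.pack S mS.
pose g := @quot_proj R B S' SZ.
have g0 b : (g b == 0) = (b \in S) by rewrite -(raddf0 g) quot_proj_eq subr0.
exists (quotmod (SZ : GRing.scaler_closed S')), g; split => // [b|q].
  split=> [/eqP|fb]; first by rewrite g0 => /asboolP.
  by apply/eqP; rewrite g0; apply/asboolP.
by exists (repr q); exact: quot_proj_surj.
Qed.

Section ProductModule.
Variables (R : pzRingType) (I : Type) (V : I -> lmodType R).

Definition prodmod : Type := forall i, V i.

HB.instance Definition _ := Choice.on prodmod.

Implicit Types x y z : prodmod.

Definition prod_zero : prodmod := fun i => 0.
Definition prod_add x y : prodmod := fun i => x i + y i.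
Definition prod_opp x : prodmod := fun i => - x i.
Definition prod_scale (a : R) x : prodmod := fun i => a *: x i.

Lemma prod_addA : associative prod_add.
Proof. by move=> x y z; apply: functional_extensionality_dep => i; exact: addrA. Qed.

Lemma prod_addC : commutative prod_add.
Proof. by move=> x y; apply: functional_extensionality_dep => i; exact: addrC. Qed.

Lemma prod_add0 : left_id prod_zero prod_add.
Proof. by move=> x; apply: functional_extensionality_dep => i; exact: add0r. Qed.

Lemma prod_addN : left_inverse prod_zero prod_opp prod_add.
Proof. by move=> x; apply: functional_extensionality_dep => i; exact: addNr. Qed.

HB.instance Definition _ :=
  GRing.isZmodule.Build prodmod prod_addA prod_addC prod_add0 prod_addN.

Lemma prod_scaleA a b x : prod_scale a (prod_scale b x) = prod_scale (a * b) x.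
Proof. by apply: functional_extensionality_dep => i; exact: scalerA. Qed.

Lemma prod_scale1 : left_id 1 prod_scale.
Proof. by move=> x; apply: functional_extensionality_dep => i; exact: scale1r. Qed.

Lemma prod_scaleDr : right_distributive prod_scale +%R.
Proof. by move=> a x y; apply: functional_extensionality_dep => i; exact: scalerDr. Qed.

Lemma prod_scaleDl x : {morph prod_scale^~ x : a b / a + b}.
Proof. by move=> a b; apply: functional_extensionality_dep => i; exact: scalerDl. Qed.

HB.instance Definition _ := GRing.Zmodule_isLmodule.Build R prodmod
  prod_scaleA prod_scale1 prod_scaleDr prod_scaleDl.

Definition prod_proj (i : I) (x : prodmod) : V i := x i.

Lemma prod_proj_linear i : linear (prod_proj i).
Proof. by []. Qed.

HB.instance Definition _ i :=
  GRing.isLinear.Build R prodmod (V i) *:%R (prod_proj i) (@prod_proj_linear i).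

Lemma prod_lift (A : lmodType R) (h : forall i, {linear A -> V i}) :
  exists k : {linear A -> prodmod}, forall a i, k a i = h i a.
Proof.
pose k a : prodmod := fun i => h i a.
have k_lin : linear k.
  by move=> a x y; apply: functional_extensionality_dep => i; exact: linearP.
pose mk := GRing.isLinear.Build R A prodmod *:%R k k_lin.
pose K : {linear A -> prodmod} := HB.pack k mk.
by exists K.
Qed.

End ProductModule.

Lemma prodmod_pure_injective (R : pzRingType) (S : lmodType R -> Prop)
    (I : Type) (V : I -> lmodType R) :
  (forall i, pure_injective S (V i)) -> pure_injective S (prodmod V).
Proof.
move=> V_inj A B C f g fg h.
have ext i : exists k : {linear B -> V i}, k \o f =1 prod_proj i \o h.
  by have [k kf] := V_inj i _ _ _ _ _ fg (prod_proj i \o h); exists k.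
have [K KE] := prod_lift (fun i => projT1 (cid (ext i))).
exists K => a; apply: functional_extensionality_dep => i.
by rewrite /= KE; exact: (projT2 (cid (ext i)) a).
Qed.

(** * Linear systems and purity *)

Section LinearSystems.
Variables (R : pzRingType) (m n : nat) (P : 'M[R]_(m, n)).

Definition system (A : lmodType R) (x : 'I_n -> A) : 'I_m -> A :=
  fun i => \sum_j P i j *: x j.

Lemma system_is_zmod_morphism (A : lmodType R) : zmod_morphism (@system A).
Proof.
move=> x y; apply/funext => i; rewrite /system -[RHS]sumrB.
by apply: eq_bigr => j _; rewrite scalerBr.
Qed.

HB.instance Definition _ (A : lmodType R) :=
  GRing.isZmodMorphism.Build ('I_n -> A) ('I_m -> A) (@system A)
    (@system_is_zmod_morphism A).

Lemma linear_system (A B : lmodType R) (f : {linear A -> B}) (x : 'I_n -> A) :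
  f \o system x = system (f \o x).
Proof.
apply/funext => i; rewrite /system /= linear_sum.
by apply: eq_bigr => j _; rewrite linearZ.
Qed.

(* U is the cokernel of the map 'rV_m -> 'rV_n given by P, with generators u,
   stated as a universal property. *)
Definition presents (U : lmodType R) (u : 'I_n -> U) : Prop :=
  [/\ system u = 0,
      forall (A : lmodType R) (x : 'I_n -> A), system x = 0 ->
        exists k : {linear U -> A}, k \o u = x
    & forall (A : lmodType R) (k k' : {linear U -> A}),
        k \o u = k' \o u -> k =1 k'].

Definition reflects_solvability (A B : lmodType R) (f : A -> B) : Prop :=
  forall (x : 'I_n -> B) (a : 'I_m -> A), system x = f \o a ->
  exists a' : 'I_n -> A, system a' = a.

(** A solution [x] in [B] maps to a solution in [C] of the homogeneous system, that is, to a map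
    from [U] to [C]. Subtracting from [x] a lift of this map leaves a solution coming from [A]. *)
Lemma presents_reflects_solvability (U A B C : lmodType R) (u : 'I_n -> U)
    (f : {linear A -> B}) (g : {linear B -> C}) :
    presents u -> injective f -> exact_at f g -> Hom_post_surjective U g ->
  reflects_solvability f.
Proof.
move=> [u0 exk _] f_inj fg lift x a xa.
have gx0 : system (g \o x) = 0.
  rewrite -linear_system xa; apply/funext => i /=; apply/fg; by exists (a i).
have [h hu] := exk _ _ gx0; have [k gk] := lift h.
have /choice[a' a'E] : forall j, exists a', f a' = x j - k (u j).
  move=> j; apply/fg; rewrite raddfB; apply/eqP; rewrite subr_eq0; apply/eqP.
  by have := congr1 (@^~ j) hu; rewrite /= -gk.
exists a'; apply/funext => i; apply: f_inj.
have -> : f (system a' i) = (f \o system a') i by [].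
rewrite linear_system (_ : f \o a' = x - (k \o u)); last exact/funext.
rewrite raddfB /= xa -linear_system u0 (_ : k \o 0 = 0) ?subr0 //.
by apply/funext => l; exact: raddf0.
Qed.

(** Lift the images of the generators to [x] in [B]. The values P x come from [A], and a solution in
    [A] of the resulting system corrects [x] so that it defines a map on [U]. *)
Lemma reflects_solvability_lift (U A B C : lmodType R) (u : 'I_n -> U)
    (f : {linear A -> B}) (g : {linear B -> C}) :
    presents u -> short_exact f g -> reflects_solvability f ->
  Hom_post_surjective U g.
Proof.
move=> [u0 exk uniq] [f_inj fg g_surj] refl h.
have /choice[x gx] : forall j, exists b, g b = h (u j) by move=> j; exact: g_surj.
have /choice[a fa] : forall i, exists a, f a = system x i.
  move=> i; apply/fg.
  have -> : g (system x i) = (g \o system x) i by [].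
  rewrite linear_system (_ : g \o x = h \o u); last exact/funext.
  by rewrite -linear_system u0 /= raddf0.
have [a' a'E] : exists a', system a' = a.
  by apply: (refl x); apply/funext => i; rewrite -fa.
have sys0 : system (x - (f \o a')) = 0.
  rewrite raddfB /= -linear_system a'E; apply/eqP; rewrite subr_eq0; apply/eqP.
  by apply/funext => i; rewrite -fa.
have [k ku] := exk _ _ sys0; exists k.
apply: (uniq _ (g \o k) h); apply/funext => j /=.
have -> : k (u j) = x j - f (a' j) by rewrite -[k (u j)]/((k \o u) j) ku.
rewrite raddfB /= gx (_ : g (f _) = 0) ?subr0 //.
by apply/fg; exists (a' j).
Qed.

End LinearSystems.

Lemma row_linear_combination (R : pzRingType) (n : nat) (A : lmodType R)
    (x : 'I_n -> A) :
  exists k : {linear 'rV[R]_n -> A}, forall v, k v = \sum_j v 0 j *: x j.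
Proof.
pose k (v : 'rV[R]_n) : A := \sum_j v 0 j *: x j.
have k_lin : linear k.
  move=> a v w; rewrite scaler_sumr -big_split /=; apply: eq_bigr => j _.
  by rewrite !mxE scalerDl scalerA.
pose mk := GRing.isLinear.Build R 'rV[R]_n A *:%R k k_lin.
pose K : {linear 'rV[R]_n -> A} := HB.pack k mk.
by exists K.
Qed.

Lemma linear_descent (R : pzRingType) (V U A : lmodType R)
    (p : {linear V -> U}) (h : {linear V -> A}) :
    surjective_map p -> (forall v, p v = 0 -> h v = 0) ->
  exists k : {linear U -> A}, k \o p =1 h.
Proof.
move=> p_surj ph; have [s sE] := choice p_surj.
have hE v w : p v = p w -> h v = h w.
  move=> pvw; apply/eqP; rewrite -subr_eq0 -raddfB; apply/eqP/ph.
  by rewrite raddfB /= pvw subrr.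
have k_lin : linear (h \o s).
  by move=> a x y; rewrite /= -linearP; apply: hE; rewrite linearP !sE.
pose mk := GRing.isLinear.Build R U A *:%R (h \o s) k_lin.
pose K : {linear U -> A} := HB.pack (h \o s) mk.
by exists K => v; apply: hE; rewrite sE.
Qed.

Lemma finitely_presented_presents (R : pzRingType) (U : lmodType R) :
  finitely_presented U ->
  exists m n (P : 'M[R]_(m, n)) (u : 'I_n -> U), presents P u.
Proof.
move=> [m [n [r [p [rp p_surj]]]]].
pose P : 'M[R]_(m, n) := \matrix_(i, j) r (delta_mx 0 i) 0 j.
pose u j := p (delta_mx 0 j).
have rE i : r (delta_mx 0 i) = \sum_j P i j *: delta_mx 0 j.
  rewrite {1}[r _]row_sum_delta; apply: eq_bigr => j _; by rewrite mxE.
have pE (A : lmodType R) (k : {linear U -> A}) v :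
    k (p v) = \sum_j v 0 j *: k (u j).
  rewrite {1}[v]row_sum_delta !linear_sum; apply: eq_bigr => j _.
  by rewrite !linearZ.
exists m, n, P, u; split.
- apply/funext => i; rewrite /system.
  under eq_bigr do rewrite -linearZ.
  by rewrite -linear_sum -rE; apply/rp; exists (delta_mx 0 i).
- move=> A x x0; have [h hE] := row_linear_combination x.
  have hr i : h (r (delta_mx 0 i)) = 0.
    rewrite hE; have := congr1 (@^~ i) x0; apply: etrans.
    by apply: eq_bigr => j _; rewrite mxE.
  have [|k kp] := @linear_descent _ _ _ _ p h p_surj.
    move=> v /rp[w <-]; rewrite [w]row_sum_delta !linear_sum big1 // => i _.
    by rewrite !linearZ /= hr scaler0.
  exists k; apply/funext => j; rewrite /= [LHS](kp (delta_mx 0 j)) hE.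
  rewrite (bigD1 j) //= mxE !eqxx scale1r big1 ?addr0 // => l /negPf lj.
  by rewrite mxE lj andbF scale0r.
- move=> A k k' kk' w; have [v <-] := p_surj w; rewrite !pE.
  by apply: eq_bigr => j _; have := congr1 (@^~ j) kk' => /= ->.
Qed.

(** * Character modules *)

Section CharacterModule.
Variables (R : pzRingType) (m n : nat) (P : 'M[R]_(m, n)).

(** This cuts out P*, the character module of the transpose of the module presented by [P], that is,
    of the cokernel of [P] acting on columns. *)
Definition character_pred : pred ('cV[R]_m -> QZ) :=
  fun psi => `[< zmod_morphism psi /\ forall y, psi (P *m y) = 0 >].

Lemma character_zmod_closed : zmod_closed character_pred.
Proof.
split; first by apply/asboolP; split=> // x y; rewrite subrr.
move=> psi chi /asboolP[psiB psi0] /asboolP[chiB chi0]; apply/asboolP.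
split=> [x y|y]; rewrite -![(psi - chi) _]/(psi _ - chi _).
  by rewrite psiB chiB !opprD addrACA.
by rewrite psi0 chi0 subrr.
Qed.

HB.instance Definition _ :=
  GRing.isZmodClosed.Build ('cV[R]_m -> QZ) character_pred character_zmod_closed.

Record character := Character {
  character_val :> 'cV[R]_m -> QZ;
  character_valP : character_val \in character_pred }.

HB.instance Definition _ := [isSub for character_val].
HB.instance Definition _ := [Choice of character by <:].
HB.instance Definition _ := [SubChoice_isSubZmodule of character by <:].

Implicit Types psi : character.

Lemma characterB psi : zmod_morphism psi.
Proof. by case: psi => psi /= /asboolP[]. Qed.

HB.instance Definition _ psi :=
  GRing.isZmodMorphism.Build 'cV[R]_m QZ psi (characterB psi).

Lemma character_mulmx psi y : psi (P *m y) = 0.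
Proof. by case: psi => psi /= /asboolP[]. Qed.

Lemma character_eq psi (chi : character) : psi =1 chi -> psi = chi.
Proof. by move=> e; apply/val_inj/funext. Qed.

(** Columns form a right module, with v a written [v *m a%:M] for a 1 x 1 matrix; precomposition
    makes the characters a left module. *)
Lemma character_scale_subproof (a : R) psi :
  (fun v => psi (v *m a%:M)) \in character_pred.
Proof.
apply/asboolP; split=> [x y|y]; first by rewrite mulmxBl raddfB.
by rewrite -mulmxA character_mulmx.
Qed.

Definition character_scale a psi := Character (character_scale_subproof a psi).

Lemma character_scaleA a b psi :
  character_scale a (character_scale b psi) = character_scale (a * b) psi.
Proof. by apply: character_eq => v /=; rewrite -mulmxA -scalar_mxM. Qed.

Lemma character_scale1 : left_id 1 character_scale.
Proof. by move=> psi; apply: character_eq => v /=; rewrite mulmx1. Qed.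

Lemma character_scaleDr : right_distributive character_scale +%R.
Proof. by move=> a psi chi; apply: character_eq. Qed.

Lemma character_scaleDl psi : {morph character_scale^~ psi : a b / a + b}.
Proof.
move=> a b; apply: character_eq => v /=.
by rewrite raddfD mulmxDr raddfD.
Qed.

HB.instance Definition _ := GRing.Zmodule_isLmodule.Build R character
  character_scaleA character_scale1 character_scaleDr character_scaleDl.

Lemma character_scaleE a psi v : (a *: psi) v = psi (v *m a%:M).
Proof. by []. Qed.

Lemma character_sumE (I : finType) (psi : I -> character) v :
  (\sum_i psi i) v = \sum_i psi i v.
Proof. by elim/big_ind2: _ => // chi d chi' d' <- <-. Qed.

(** The pure tensor of [v] and [a], when A^m is identified with the tensor product of R^m and [A]
    over [R]. *)
Definition smul_vec (A : lmodType R) (v : 'cV[R]_m) (a : A) : 'I_m -> A :=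
  fun i => v i 0 *: a.

(** Tensor-Hom adjunction: a character of the tensor product of the cokernel of [P] with [A] is a
    linear map from [A] to P*. *)
Lemma character_transpose (A : lmodType R) (chi : {additive ('I_m -> A) -> QZ}) :
    (forall x, chi (system P x) = 0) ->
  exists h : {linear A -> character}, forall a v, h a v = chi (smul_vec v a).
Proof.
move=> chi0.
have h_subproof a : (fun v => chi (smul_vec v a)) \in character_pred.
  apply/asboolP; split=> [x y|y].
    rewrite -raddfB; congr (chi _); apply/funext => i.
    by rewrite /smul_vec !mxE scalerBl.
  rewrite -[RHS](chi0 (fun j => y j 0 *: a)); congr (chi _); apply/funext => i.
  rewrite /smul_vec mxE scaler_suml; apply: eq_bigr => j _.
  by rewrite scalerA.
pose h a := Character (h_subproof a).
have h_lin : linear h.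
  move=> r a b; apply: character_eq => v.
  rewrite -[RHS]/(chi (smul_vec (v *m r%:M) a) + chi (smul_vec v b)) -raddfD.
  congr (chi _); apply/funext => i; rewrite -[RHS]/((v *m r%:M) i 0 *: a + v i 0 *: b).
  by rewrite /smul_vec scalerDr scalerA mxE big_ord1 mxE eqxx.
pose mh := GRing.isLinear.Build R A character *:%R h h_lin.
pose H : {linear A -> character} := HB.pack h mh.
by exists H.
Qed.

(** The counit of this adjunction: the character of m-tuples that corresponds to the identity map of
    P*. *)
Definition character_eval (psi : 'I_m -> character) : QZ :=
  \sum_i psi i (delta_mx i 0).

Lemma character_eval_is_zmod_morphism : zmod_morphism character_eval.
Proof. by move=> x y; rewrite -sumrB. Qed.

HB.instance Definition _ := GRing.isZmodMorphism.Build ('I_m -> character) QZ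
  character_eval character_eval_is_zmod_morphism.

(** With the coefficients moved to the argument, the terms in [y j] add up to the value of [y j] at
    column j of [P], which lies in the image of [P]. *)
Lemma character_eval_system (y : 'I_n -> character) :
  character_eval (system P y) = 0.
Proof.
rewrite /character_eval /system.
under eq_bigr do rewrite character_sumE.
rewrite exchange_big big1 // => j _.
under eq_bigr do rewrite character_scaleE.
rewrite -raddf_sum -[RHS](character_mulmx (y j) (delta_mx j 0)).
congr (y j _); apply/matrixP => i k; rewrite summxE ord1 -colE mxE.
rewrite (bigD1 i) //= big1 ?addr0 => [|l /negPf li].
  by rewrite mxE big_ord1 !mxE !eqxx mul1r.
by rewrite mxE big_ord1 !mxE eq_sym li mul0r.
Qed.

End CharacterModule.

(** * Extension and detection properties of P* *)

Section CharacterInjectivity.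
Variables (R : pzRingType) (m n : nat) (P : 'M[R]_(m, n)).

(** Evaluation inverts the transposition: expand [v] in the standard columns [delta_mx i 0] and use
    linearity of [h]. *)
Lemma character_eval_smul_vec (A : lmodType R) (h : {linear A -> character P})
    (v : 'cV[R]_m) (a : A) :
  character_eval (h \o smul_vec v a) = h a v.
Proof.
have ve : v = \sum_i delta_mx i 0 *m (v i 0)%:M.
  apply/matrixP => i k; rewrite summxE ord1 (bigD1 i) //= big1 ?addr0 => [|l /negPf li].
    by rewrite mxE big_ord1 !mxE !eqxx mul1r.
  by rewrite mxE big_ord1 !mxE eq_sym li mul0r.
rewrite [in RHS]ve raddf_sum; apply: eq_bigr => i _.
by rewrite /= linearZ.
Qed.

Lemma character_eval_linear_zmod (A : lmodType R) (h : {linear A -> character P}) :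
  zmod_morphism (fun a : 'I_m -> A => character_eval (h \o a)).
Proof.
move=> a b; rewrite -raddfB; congr character_eval.
by apply/funext => i; exact: raddfB.
Qed.

(** Under the adjunction [h] becomes the character [theta] of A^m. It is carried over to B^m so as
    to vanish on P B^n, and transposed back. *)
Lemma character_extension (A B : lmodType R) (f : {linear A -> B})
    (h : {linear A -> character P}) :
  reflects_solvability P f -> exists k : {linear B -> character P}, k \o f =1 h.
Proof.
move=> refl; pose theta (a : 'I_m -> A) := character_eval (h \o a).
have thetaB a b : theta (a - b) = theta a - theta b.
  exact: character_eval_linear_zmod.
pose F : set (('I_m -> B) * QZ) :=
  [set u | exists a y, u = ((f \o a) + system P y, theta a)].
have theta_sys y : theta (system P y) = 0.
  by rewrite /theta linear_system character_eval_system.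
have theta0 : theta 0 = 0 by have := thetaB 0 0; rewrite !subrr.
(* F prescribes a character of B^m that extends theta along f and kills system P;
   it is single-valued because f reflects solvability. *)
have gF : additive_graph F.
  split.
  - exists 0, 0; rewrite theta0 raddf0 addr0; congr pair.
    by apply/funext => i; rewrite /= raddf0.
  - move=> _ _ [a [y ->]] [b [z ->]]; exists (a - b), (y - z).
    rewrite thetaB raddfB; congr pair; apply/funext => i.
    rewrite -[LHS]/(f (a i) + system P y i - (f (b i) + system P z i)).
    rewrite -[RHS]/(f (a i - b i) + (system P y i - system P z i)).
    by rewrite raddfB /= opprD addrACA.
  - move=> d [a [y [fay ->]]].
    (* Here f a = P(-y) is solvable in [B], so [a] lies in P A^n, where [theta] vanishes. *)
    have [|a' <-] := refl (- y) a; last exact: theta_sys.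
    apply/esym/eqP; rewrite raddfN /= -addr_eq0; exact/eqP.
have [chi chiF] := additive_graph_extension divisible_QZ gF.
have chi0 y : chi (system P y) = 0.
  apply: (chiF (system P y, 0)); exists 0, y; rewrite theta0; congr pair.
  by apply/funext => i; rewrite -[RHS]/(f 0 + system P y i) raddf0 add0r.
have chif a : chi (f \o a) = theta a.
  by apply: (chiF (f \o a, theta a)); exists a, 0; rewrite raddf0 addr0.
have [k kE] := character_transpose chi0.
exists k => a; apply: character_eq => v.
rewrite /= kE (_ : smul_vec v (f a) = f \o smul_vec v a).
  by rewrite chif; exact: character_eval_smul_vec.
by apply/funext => i; rewrite /smul_vec /= linearZ.
Qed.

(** A character separating [a] from P A^n has a transpose [h] for which evaluation at [h \o a] is
    nonzero, whereas evaluation vanishes on every [system P y]. *)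
Lemma character_detects_solvability (A : lmodType R) (a : 'I_m -> A) :
    (forall (h : {linear A -> character P}), exists y, system P y = h \o a) ->
  exists a', system P a' = a.
Proof.
move=> solvable; apply: contrapT => nsolv.
pose H : set ('I_m -> A) := [set b | exists x, system P x = b].
have [|x y [x' <-] [y' <-]|//|chi chiH] := @QZ_separation _ H a.
- by exists 0; rewrite raddf0.
- by exists (x' - y'); rewrite raddfB.
have [h hE] : exists h : {linear A -> character P}, _ :=
  @character_transpose _ _ _ _ _ chi (fun x => chiH _ (ex_intro _ x erefl)).
have [y /(congr1 (@character_eval _ _ _ P))] := solvable h.
rewrite character_eval_system => /esym h0 /eqP[]; rewrite -[RHS]h0.
have aE : a = \sum_i smul_vec (delta_mx i 0) (a i).
  apply/funext => l; rewrite fct_sumE (bigD1 l) //= big1 ?addr0 => [|i /negPf il].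
    by rewrite /smul_vec mxE !eqxx scale1r.
  by rewrite /smul_vec mxE eq_sym il scale0r.
rewrite [in LHS]aE raddf_sum; apply: eq_bigr => i _; by rewrite hE.
Qed.

End CharacterInjectivity.

(** * Construction of the preenvelope *)

(* Quantifying over systems rather than over the modules of S keeps the index type
   of the product below in the universe of the carriers of R-modules. *)
Record pure_system (R : pzRingType) (S : lmodType R -> Prop) := PureSystem {
  ps_rows : nat;
  ps_cols : nat;
  ps_mx : 'M[R]_(ps_rows, ps_cols);
  ps_pure : forall (A B C : lmodType R) (f : {linear A -> B}) (g : {linear B -> C}),
    pure_exact S f g -> reflects_solvability ps_mx f }.

Theorem proposition2p8 (R : pzRingType) (S : lmodType R -> Prop)
    (S_set : set_presentable S)
    (S_fp : forall U : lmodType R, S U -> finitely_presented U)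
    (S_R : S R^o)
    (M : lmodType R) :
  exists (X : lmodType R) (phi : {linear M -> X}),
    is_preenvelope (pure_injective S) phi.
Proof.
pose I := {s : pure_system S & {linear M -> character (ps_mx s)}}.
pose V (i : I) : lmodType R := character (ps_mx (tag i)).
have [phi phiE] := prod_lift (V := V) (fun i => tagged i).
(* A solution in the product, projected to the factor indexed by [h], solves the system for
   [h \o a]; this is what detection by characters asks for. *)
have refl (s : pure_system S) : reflects_solvability (ps_mx s) phi.
  move=> x a xa; apply: character_detects_solvability => h.
  pose i : I := Tagged _ h.
  exists (prod_proj i \o x); rewrite -(linear_system _ (prod_proj (V := V) i)) xa.
  by apply/funext => j; rewrite /= /prod_proj phiE.
have phi_inj : injective phi.
  (* The system without unknowns, 0 = a, is solvable only for a = 0 and is reflected by every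
     injection. Applied to the difference of two points with equal image, it gives injectivity. *)
  have zero_pure (A B C : lmodType R) (f : {linear A -> B}) (g : {linear B -> C}) :
      pure_exact S f g -> reflects_solvability (0 : 'M[R]_(1, 0)) f.
    move=> [[f_inj _ _] _] x a xa; exists (fun=> 0); apply/funext => i; apply: f_inj.
    by rewrite -[RHS]/((f \o a) i) -xa /system !big_ord0 raddf0.
  move=> a b ab; apply/eqP; rewrite -subr_eq0; apply/eqP.
  have [|a' a'E] := refl (PureSystem zero_pure) (fun=> 0) (fun=> a - b).
    by apply/funext => i; rewrite /system /= big_ord0 raddfB /= ab subrr.
  by have := congr1 (@^~ ord0) a'E; rewrite /system big_ord0.
have [C [g phig]] := cokernel phi_inj.
exists (prodmod V), phi; split.
  apply: prodmod_pure_injective => i A B D f k fk h.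
  exact: (character_extension h (ps_pure (p := tag i) fk)).
move=> E E_inj; apply: (E_inj _ _ _ phi g); split => // U SU.
have [m [n [P [u Pu]]]] := finitely_presented_presents (S_fp U SU).
apply: (reflects_solvability_lift Pu phig).
(* The matrix presenting [U] belongs to the index family, since every S-pure sequence lifts maps
   from [U]; hence [phi] reflects its solvability. *)
apply: (refl (@PureSystem _ _ _ _ P _)) => A B D f k [[f_inj fk _] lift].
exact: (presents_reflects_solvability Pu f_inj fk (lift U SU)).
Qed.
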